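(* Let $X \neq \{0\}$ be a real Banach space with the Daugavet property. Then there exist convex closed bounded sets $A, D \subset X$ such that $A$ and $D$ are SCD but the Minkowski sum $A + D=\{a+d : a\in A,\ d\in D\}$ is not SCD.
   Context: All Banach spaces are real. For a non-empty bounded set $A \subset X$, a slice of $A$ is a (non-empty) set of the form $S(A,x^*,\varepsilon)=\{x\in A : x^*(x) > \sup_{a\in A} x^*(a)-\varepsilon\}$ with $x^*\in X^*\setminus\{0\}$ and $\varepsilon>0$. A sequence $(U_n)_{n\in\mathbb N}$ of non-empty subsets of a bounded set $A\subset X$ is called determining (for $A$) if for every $B\subset X$ with $B\cap U_n\neq\emptyset$ for all $n$ one has $A\subset\overline{\mathrm{conv}}(B)$ (norm-closed convex hull). A bounded set $A$ is SCD (slicely countably determined) if it has a determining sequence consisting of slices of $A$. A Banach space $X$ has the Daugavet property if every bounded linear rank-one operator $T\colon X\to X$ satisfies $\|I+T\|=1+\|T\|$. *)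

(* Defs.v *)
From HB Require Import structures.
From mathcomp Require Import all_boot all_order all_algebra.
From mathcomp Require Import boolp classical_sets functions reals topology.
From mathcomp Require Import normedtype sequences convex.

Set Implicit Arguments.
Unset Strict Implicit.
Unset Printing Implicit Defensive.

Import Order.TTheory GRing.Theory Num.Theory.
Import numFieldNormedType.Exports.

Local Open Scope classical_set_scope.
Local Open Scope ring_scope.

Section banach_space.
Variables (R : realType) (X : completeNormedModType R).
Implicit Types (A B D : set X) (U : (set X)^nat).

(* The library has no operator norm; for a bounded linear operator this is the
   usual one, the supremum ranging over the closed unit ball. *)
Definition opnorm (T : X -> X) : R :=
  sup [set `|T x| | x in [set x : X | `|x| <= 1]].

Definition rank_one (T : X -> X) : Prop :=
  exists2 y : X, y != 0 & range T = [set c *: y | c in [set: R]].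

Definition Daugavet_property : Prop :=
  forall T : {linear X -> X}, bounded_fun_norm T -> rank_one T ->
    opnorm (fun x => x + T x) = 1 + opnorm T.

Definition slice A (f : X -> R) (e : R) : set X :=
  [set x | A x /\ sup (f @` A) - e < f x].

(* Slices are non-empty by convention; [sup] is the actual supremum only when
   A is non-empty and bounded, which is the only case of interest. *)
Definition is_slice A (S : set X) : Prop :=
  S !=set0 /\
  exists (f : {linear X -> R^o}) (e : R),
    [/\ continuous f, exists x, f x != 0, 0 < e & S = slice A f e].

Definition convex_hull B : set X := smallest (@convex_set R X) B.

Definition determining A U : Prop :=
  (forall n, U n !=set0 /\ U n `<=` A) /\
  forall B, (forall n, B `&` U n !=set0) -> A `<=` closure (convex_hull B).

(* To be used for bounded A. *)
Definition SCD A : Prop :=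
  exists2 U, forall n, is_slice A (U n) & determining A U.

Definition minkowski_sum A D : set X := [set a + d | a in A & d in D].

End banach_space.

Arguments Daugavet_property {R} X.

(* Main.v *)
Require Import Defs.
From HB Require Import structures.
From mathcomp Require Import all_boot all_order all_algebra finmap ring lra.
From mathcomp Require Import boolp classical_sets functions reals topology.
From mathcomp Require Import interval_inference normedtype sequences convex.

Set Implicit Arguments.
Unset Strict Implicit.
Unset Printing Implicit Defensive.

Import Order.TTheory GRing.Theory Num.Theory.
Import numFieldNormedType.Exports.

Local Open Scope classical_set_scope.
Local Open Scope ring_scope.

(** The two sets are closed hulls of the same sequence of vectors of a hyperplane,
    lifted to opposite sides of it.

    Fix a functional [phi] of norm 1 and a unit vector [e] with [phi e = 1].  The
    Daugavet property provides, in every slice of the unit ball and for every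
    compact set [K], a vector [v] with [`|w - v|] almost equal to [`|w| + 1] for all
    [w] in [K] ([slice_meets_l1_far]); by mixing two such vectors the same holds in
    the unit sphere of [ker phi] ([ex_unit_kernel_l1_far]), and by separation the
    vectors of that sphere far from [K] have the whole unit ball of [ker phi] as
    closed convex hull ([kernel_sub_closed_hull_l1_far]).  Iterating this countably
    often gives unit vectors [y n] of [ker phi] such that each of them is in the closed
    convex hull of later terms that are far from any prescribed bounded set of
    combinations of earlier terms ([ex_tree_sequence]).  A sequence is enough even if
    the space is not separable.

    Let [A] and [D] be the closed convex hulls of the points
    [(1 - s_n ^+ 2) *: y n + s_n *: e] and [(1 - s_n ^+ 2) *: y n - s_n *: e], where
    [s_n = 1 / (n + 1)].  The coefficients run on a strictly concave curve, so
    these points are strongly exposed, and countably many slices around them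
    determine [A] and [D] ([SCD_lift]).

    In a direction [f] with [f e <= 0] the lift by [+ s_n *: e] is useless, and the
    slices of [A] contain points [y n] themselves, together with far vectors [y j]
    approximating them in the direction [f]; for [f e >= 0] this happens for [D].  A
    slice of [A + D] in the direction [f] contains sums of slices of [A] and [D] in
    the same direction, so it always contains points with a far component
    ([slice_has_far]).  Picking such points successively in countably many slices
    of [A + D] keeps their closed convex hull away from [2 *: y 0], which lies in
    [A + D] ([lift_sum_not_SCD]). *)

(** * Sublinear functionals and the Hahn-Banach theorem *)

Section hahn_banach.
Variables (R : realType) (X : lmodType R).
Implicit Types (p q : X -> R) (G : set (X * R)) (x y : X) (t : R).

Definition sublinear p : Prop :=
  (forall x y, p (x + y) <= p x + p y) /\
  (forall t x, 0 < t -> p (t *: x) <= t * p x).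

(** Convex cones of pairs (c, s), to be read as a list of demands: the linear
    functional [f] sought must satisfy [s <= f c]. *)
Definition cone_set G : Prop :=
  [/\ G (0, 0),
      forall g h, G g -> G h -> G (g.1 + h.1, g.2 + h.2) &
      forall t g, 0 < t -> G g -> G (t *: g.1, t * g.2)].

Lemma sublinear0 p : sublinear p -> p 0 = 0.
Proof.
case=> pD pZ; have := pD 0 0; rewrite addr0.
have : p (2^-1 *: 0) <= 2^-1 * p 0 by apply: pZ; lra.
by rewrite scaler0; lra.
Qed.

Lemma sublinear_opp p x : sublinear p -> 0 <= p x + p (- x).
Proof. by move=> sp; rewrite -(sublinear0 sp) -(subrr x); exact: sp.1. Qed.

(** The largest sublinear functional [q] below [p] with [q (- c) <= - s] for
    every demand (c, s): a linear functional below it is below [p] and meets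
    all the demands. *)
Definition infconv p G : X -> R :=
  fun x => inf [set p (x + g.1) - g.2 | g in G].

Section infconv.
Variables (p : X -> R) (G : set (X * R)).
Hypotheses (sp : sublinear p) (cG : cone_set G).
Hypothesis Gp : forall g, G g -> g.2 <= p g.1.

Let lbG x : has_lbound [set p (x + g.1) - g.2 | g in G].
Proof.
exists (- p (- x)) => _ [g Gg <-].
have := sp.1 (x + g.1) (- x); rewrite addrAC subrr add0r.
by have := Gp Gg; lra.
Qed.

Lemma infconv_le x g : G g -> infconv p G x <= p (x + g.1) - g.2.
Proof. by move=> Gg; apply: ge_inf => //; exists g. Qed.

Lemma infconv_adherent x t : infconv p G x < t ->
  exists2 g, G g & p (x + g.1) - g.2 < t.
Proof.
move=> xt.
have [||_ [g Gg <-] gt] := @inf_adherent _ [set p (x + g.1) - g.2 | g in G]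
   (t - infconv p G x).
- by rewrite subr_gt0.
- split; last exact: lbG.
  by exists (p (x + 0) - 0); exists (0, 0) => //; case: cG.
- by exists g => //; rewrite (lt_le_trans gt)// addrCA subrr addr0.
Qed.

Lemma infconv_sublinear : sublinear (infconv p G).
Proof.
case: cG => _ GD GZ; split=> [x y|t x t0].
  apply/ler_addgt0Pr => e e0.
  have [|g Gg gx] := @infconv_adherent x (infconv p G x + e / 2); first lra.
  have [|h Gh hy] := @infconv_adherent y (infconv p G y + e / 2); first lra.
  apply: (le_trans (infconv_le _ (GD _ _ Gg Gh))) => /=.
  by have := sp.1 (x + g.1) (y + h.1); rewrite addrACA; lra.
apply/ler_addgt0Pr => e e0.
have [|g Gg gx] := @infconv_adherent x (infconv p G x + e / t).
  by rewrite ltrDl divr_gt0.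
apply: (le_trans (infconv_le _ (GZ _ _ t0 Gg))) => /=.
rewrite -scalerDr.
have := sp.2 _ (x + g.1) t0.
move: gx; rewrite -(ltr_pM2l t0) mulrBr mulrDr (mulrCA t e) divff ?gt_eqF//.
by lra.
Qed.

Lemma infconv_le_p x : infconv p G x <= p x.
Proof. by have := @infconv_le x (0, 0); rewrite /= addr0 subr0; apply; case: cG. Qed.

Lemma infconvN g : G g -> infconv p G (- g.1) <= - g.2.
Proof.
move=> Gg; apply: (le_trans (infconv_le _ Gg)).
by rewrite addNr sublinear0// sub0r.
Qed.

End infconv.

(** Being sublinear bounds each [q x] from below by [- q (- x)], which keeps
    the pointwise infimum of a chain finite; this feeds the lemma of Zorn. *)
Lemma chain_inf_sublinear (A : set (X -> R)) p :
  (forall q, A q -> sublinear q) -> A p ->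
  (forall q q', A q -> A q' -> (forall x, q x <= q' x) \/ (forall x, q' x <= q x)) ->
  let m x := inf [set q x | q in A] in
  sublinear m /\ forall q, A q -> forall x, m x <= q x.
Proof.
move=> As Ap Atot m.
have lbA x : has_lbound [set q x | q in A].
  exists (- p (- x)) => _ [q Aq <-]; have [qp|pq] := Atot _ _ Aq Ap.
    by have := sublinear_opp x (As _ Aq); have := qp (- x); lra.
  by have := sublinear_opp x (As _ Ap); have := pq x; lra.
have mle q x : A q -> m x <= q x.
  by move=> Aq; apply: ge_inf => //; exists q.
have mad x t : m x < t -> exists2 q, A q & q x < t.
  move=> xt; have [||_ [q Aq <-] qt] := @inf_adherent _ [set q x | q in A]
      (t - m x).
  - by rewrite subr_gt0.
  - by split; [exists (p x), p|exact: lbA].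
  - by exists q => //; rewrite (lt_le_trans qt)// addrCA subrr addr0.
split; last by move=> q Aq x; exact: mle.
split=> [x y|t x t0]; apply/ler_addgt0Pr => e e0.
  have [|q Aq qx] := mad x (m x + e / 2); first lra.
  have [|r Ar ry] := mad y (m y + e / 2); first lra.
  have [qr|rq] := Atot _ _ Aq Ar.
    apply: (le_trans (mle _ _ Aq)).
    by have := (As _ Aq).1 x y; have := qr y; lra.
  apply: (le_trans (mle _ _ Ar)).
  by have := (As _ Ar).1 x y; have := rq x; lra.
have [|q Aq qx] := mad x (m x + e / t); first by rewrite ltrDl divr_gt0.
apply: (le_trans (mle _ _ Aq)).
have := (As _ Aq).2 _ x t0.
move: qx; rewrite -(ltr_pM2l t0) mulrDr (mulrCA t e) divff ?gt_eqF//.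
by lra.
Qed.

Lemma minimal_sublinear p : sublinear p -> exists q,
  [/\ sublinear q, forall x, q x <= p x &
      forall r, sublinear r -> (forall x, r x <= q x) -> r = q].
Proof.
move=> sp.
pose T := {q : X -> R | sublinear q /\ forall x, q x <= p x}.
pose le (q r : T) := `[< forall x, sval r x <= sval q x >].
have le_anti (s t : T) : le s t -> le t s -> s = t.
  move=> /asboolP st /asboolP ts.
  case: s t st ts => [s Hs] [t Ht] /= st ts.
  apply: eq_exist; apply/funext => x; apply/eqP.
  by rewrite eq_le ts st.
have [t|r s t|//|A Atot|q qmin] := @Zorn T le.
- by apply/asboolP.
- move=> /asboolP rs /asboolP st; apply/asboolP => x.
  exact: le_trans (st x) (rs x).
- have [[a Aa]|A0] := pselect (A !=set0); last first.
    exists (exist _ p (conj sp (fun x => lexx (p x)))) => s As.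
    by exfalso; apply: A0; exists s.
  have [||| sm mle] := @chain_inf_sublinear [set sval q | q in A] (sval a).
  + by move=> _ [[q [? ?]] _ <-].
  + by exists a.
  + move=> _ _ [q Aq <-] [r Ar <-].
    by have [/asboolP qr|/asboolP rq] := Atot _ _ Aq Ar; [right|left].
  set m := (fun x => inf _) in sm mle.
  have mp x : m x <= p x.
    apply: (@le_trans _ _ (sval a x)); first by apply: mle; exists a.
    by case: a {Aa mle} => a [? ?] /=.
  exists (exist _ m (conj sm mp)) => s As; apply/asboolP => x /=.
  by apply: mle; exists s.
- exists (sval q); split; [by case: q {qmin} => q []|by case: q {qmin} => q []|].
  move=> r sr rq.
  have rp x : r x <= p x.
    by apply: (le_trans (rq x)); case: q {qmin rq} => q [].
  have := qmin (exist _ r (conj sr rp)); move=> <- //.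
  exact/asboolP.
Qed.

(** For fixed [y], the inf-convolution of [q] with the cone spanned by
    [(y, q y)] is a sublinear functional below [q], hence equal to [q] by
    minimality; this equality says that [q (x + y) >= q x + q y]. *)
Lemma minimal_sublinear_linear q : sublinear q ->
  (forall r, sublinear r -> (forall x, r x <= q x) -> r = q) -> linear (q : X -> R^o).
Proof.
move=> sq qmin.
have qZ t x : 0 < t -> q (t *: x) = t * q x.
  move=> t0; apply/eqP; rewrite eq_le sq.2//=.
  have := @sq.2 t^-1 (t *: x); rewrite invr_gt0 => /(_ t0).
  rewrite scalerA mulVf ?gt_eqF// scale1r -(ler_pM2l t0) mulrA divff ?gt_eqF//.
  by rewrite mul1r.
have qD x y : q (x + y) = q x + q y.
  apply/eqP; rewrite eq_le sq.1/=.
  pose G : set (X * R) := [set (t *: y, t * q y) | t in [set t | 0 <= t]].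
  have cG : cone_set G.
    split.
    - by exists 0 => //=; rewrite scale0r mul0r.
    - move=> _ _ [s s0 <-] [t t0 <-]; exists (s + t) => /=; first exact: addr_ge0.
      by rewrite scalerDl mulrDl.
    - move=> s _ s0 [t t0 <-]; exists (s * t) => /=; first by rewrite mulr_ge0// ltW.
      by rewrite scalerA mulrA.
  have Gq g : G g -> g.2 <= q g.1.
    move=> [t /= t0 <-] /=.
    move: t0; rewrite le_eqVlt => /predU1P[<-|t0]; last by rewrite qZ.
    by rewrite scale0r mul0r sublinear0.
  have := qmin _ (infconv_sublinear sq cG Gq) (infconv_le_p sq cG Gq).
  move=> /(congr1 (fun f => f x)) <-.
  rewrite -lerBrDr.
  have := @infconv_le _ _ sq Gq x (1 *: y, 1 * q y).
  rewrite /= scale1r mul1r; apply.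
  by exists 1 => //=; rewrite ?scale1r ?mul1r.
have q0 := sublinear0 sq.
have qN x : q (- x) = - q x.
  by have := qD x (- x); rewrite subrr q0; lra.
move=> t x y; rewrite qD; congr (_ + _).
have [t0|t0|->] := ltgtP t 0; last by rewrite !scale0r.
- rewrite -[t]opprK scaleNr qN qZ ?oppr_gt0//.
  by rewrite scaleNr.
- by rewrite qZ.
Qed.

(** This form (due to Mazur and Orlicz) yields, for suitable cones, norming
    functionals, separation of convex sets and norm-preserving extension. *)
Theorem hahn_banach_cone p G : sublinear p -> cone_set G ->
  (forall g, G g -> g.2 <= p g.1) ->
  exists f : {linear X -> R^o},
    (forall x, f x <= p x) /\ (forall g, G g -> g.2 <= f g.1).
Proof.
move=> sp cG Gp.
have [q [sq qp qmin]] := minimal_sublinear (infconv_sublinear sp cG Gp).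
have lq := minimal_sublinear_linear sq qmin.
pose isL := GRing.isLinear.Build _ _ _ _ (q : X -> R^o) lq.
pose f : {linear X -> R^o} := HB.pack (q : X -> R^o) isL.
exists f; split=> [x|g Gg].
  exact: le_trans (qp x) (infconv_le_p sp cG Gp x).
rewrite -lerN2 -linearN; apply: (le_trans (qp _)).
exact: infconvN.
Qed.

End hahn_banach.

(** * Continuous functionals, closed convex hulls and separation *)

Section functionals.
Variables (R : realType) (X : completeNormedModType R).
Implicit Types (f : {linear X -> R^o}) (x : X).

Lemma functionalZ f (t : R) x : f (t *: x) = t * f x.
Proof. exact: linearZ. Qed.

Lemma dominated_norm f M : (forall x, f x <= M * `|x|) ->
  forall x, `|f x| <= M * `|x|.
Proof.
move=> fM x; rewrite ler_norml fM andbT lerNl -linearN.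
by rewrite -(normrN x); exact: fM.
Qed.

Lemma dominated_continuous f M : (forall x, f x <= M * `|x|) -> continuous f.
Proof.
move=> /dominated_norm fM; apply/linear_bounded_continuous/bounded_funP => r.
exists (`|M| * r) => x xr; apply: (le_trans (fM x)).
apply: (@le_trans _ _ (`|M| * `|x|)); first by rewrite ler_wpM2r// ler_norm.
by rewrite ler_wpM2l.
Qed.

Lemma continuous_bound f : continuous f ->
  exists2 M : R, 0 < M & forall x, `|f x| <= M * `|x|.
Proof.
move=> /linear_bounded_continuous/linear_boundedP[M [_ fM]].
exists (`|M| + 1); first by rewrite ltr_wpDl.
by apply: fM; rewrite (le_lt_trans (ler_norm _))// ltrDl.
Qed.

End functionals.

Section convexity.
Variables (R : realType) (X : completeNormedModType R).
Implicit Types (A B C V : set X) (f : {linear X -> R^o}) (x y : X) (t : R).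

Lemma convexP C : convex_set C <->
  forall x y t, 0 <= t -> t <= 1 -> C x -> C y -> C (t *: x + (1 - t) *: y).
Proof.
split=> [cC x y t t0 t1 Cx Cy|cC x y t /set_mem Cx /set_mem Cy].
  have := cC x y (Itv01 t0 t1) (mem_set Cx) (mem_set Cy).
  by move=> /set_mem.
by apply/mem_set/cC.
Qed.

Lemma sub_convex_hull B : B `<=` convex_hull B.
Proof. exact: sub_gen_smallest. Qed.

Lemma convex_hull_convex B : convex_set (convex_hull B).
Proof.
apply/convexP => x y t t0 t1 Bx By C [cC BC].
by apply: (convexP C).1 => //; [exact: Bx|exact: By].
Qed.

Lemma convex_hull_min B C : convex_set C -> B `<=` C -> convex_hull B `<=` C.
Proof. by move=> cC BC; exact: smallest_sub. Qed.

Lemma closure_normP A x :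
  closure A x <-> forall e : R, 0 < e -> exists2 a, A a & `|x - a| < e.
Proof.
split=> [clA e e0|H B /nbhs_ballP[e /= e0 eB]].
  have [a [Aa]] := clA _ (nbhsx_ballx x e e0).
  by rewrite -ball_normE => /= xa; exists a.
have [a Aa xa] := H e e0; exists a; split=> //; apply: eB.
by rewrite -ball_normE.
Qed.

Lemma closure_convex C : convex_set C -> convex_set (closure C).
Proof.
move=> cC; apply/convexP => x y t t0 t1 /closure_normP Cx /closure_normP Cy.
apply/closure_normP => e e0.
have [a Ca xa] := Cx e e0; have [b Cb yb] := Cy e e0.
exists (t *: a + (1 - t) *: b); first exact: (convexP C).1.
rewrite opprD addrACA -!scalerBr (le_lt_trans (ler_normD _ _))// !normrZ.
rewrite (ger0_norm t0) ger0_norm ?subr_ge0//.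
by have [t2|t2] := leP 2^-1 t; nra.
Qed.

Lemma convex_hullS (A B : set X) : A `<=` B -> convex_hull A `<=` convex_hull B.
Proof.
move=> AB; apply: convex_hull_min; first exact: convex_hull_convex.
by move=> x /AB; exact: sub_convex_hull.
Qed.

Lemma convex_hull0 : convex_hull (@set0 X) = set0.
Proof.
by apply/seteqP; split=> //; apply: convex_hull_min => //; apply/convexP.
Qed.

Definition closed_hull B : set X := closure (convex_hull B).

Lemma closed_hull_convex B : convex_set (closed_hull B).
Proof. by apply: closure_convex; exact: convex_hull_convex. Qed.

Lemma closed_hull_closed B : closed (closed_hull B).
Proof. exact: closed_closure. Qed.

Lemma sub_closed_hull B : B `<=` closed_hull B.
Proof. by move=> x Bx; apply: subset_closure; exact: sub_convex_hull. Qed.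

Lemma closed_hull_min B C :
  convex_set C -> closed C -> B `<=` C -> closed_hull B `<=` C.
Proof.
move=> cC clC BC; rewrite /closed_hull [C](closure_id C).1//.
by apply: closureS; apply: convex_hull_min.
Qed.

Lemma closed_hullS B C : B `<=` closed_hull C -> closed_hull B `<=` closed_hull C.
Proof.
by apply: closed_hull_min; [exact: closed_hull_convex|exact: closed_hull_closed].
Qed.

Lemma halfspace_convex f (b : R) : convex_set [set x : X | f x <= b].
Proof.
apply/convexP => x y t t0 t1 /= fx fy.
by rewrite linearD !functionalZ; nra.
Qed.

Lemma closed_hull_le B f (b : R) : continuous f ->
  (forall x, B x -> f x <= b) -> forall x, closed_hull B x -> f x <= b.
Proof.
move=> cf Bf; apply: closed_hull_min => //; first exact: halfspace_convex.
apply: (@preimage_closed _ _ f [set r | r <= b]); last exact: closed_le.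
by move=> x _; exact: cf.
Qed.

Lemma closed_hull_dist B y (r : R) :
  (forall x, B x -> `|x - y| <= r) -> forall x, closed_hull B x -> `|x - y| <= r.
Proof.
move=> Br x; rewrite distrC; move: x.
apply: (@closed_hull_min B (closed_ball_ Num.norm y r)); last first.
- by move=> x /Br; rewrite distrC.
- exact: closed_closed_ball_.
- apply/convexP => x z t t0 t1; rewrite /closed_ball_ /= ![ `|y - _|]distrC => xy zy.
  have -> : t *: x + (1 - t) *: z - y = t *: (x - y) + (1 - t) *: (z - y).
    by rewrite !scalerBr addrACA -opprD -scalerDl (addrC t) subrK scale1r.
  rewrite (le_trans (ler_normD _ _))// !normrZ.
  rewrite (ger0_norm t0) ger0_norm ?subr_ge0//.
  by nra.
Qed.

(** The points reached by finite subsets form a convex set: concatenate the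
    two lists. *)
Lemma convex_hull_finite V x : convex_hull V x ->
  exists2 l : seq X, (forall v, v \in l -> V v) & convex_hull [set` l] x.
Proof.
pose C : set X := [set x | exists2 l : seq X,
  (forall v, v \in l -> V v) & convex_hull [set` l] x].
apply: (@convex_hull_min V C).
  apply/convexP => y z t t0 t1 [l lV ly] [k kV kz].
  exists (l ++ k); first by move=> v; rewrite mem_cat => /orP[/lV|/kV].
  apply: (convexP (convex_hull [set` l ++ k])).1 => //.
  - exact: convex_hull_convex.
  - apply: (convex_hull_min _ _ ly); first exact: convex_hull_convex.
    by move=> v /= vl; apply: sub_convex_hull; rewrite /= mem_cat vl.
  - apply: (convex_hull_min _ _ kz); first exact: convex_hull_convex.
    by move=> v /= vl; apply: sub_convex_hull; rewrite /= mem_cat vl orbT.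
move=> v Vv; exists [:: v]; first by move=> w; rewrite inE => /eqP ->.
by apply: sub_convex_hull; rewrite /= inE.
Qed.

Lemma norm_sublinear (M : R) : 0 <= M -> sublinear (fun x : X => M * `|x|).
Proof.
move=> M0; split=> [x y|t x t0].
  by rewrite -mulrDr ler_wpM2l// ler_normD.
by rewrite normrZ gtr0_norm// mulrCA.
Qed.

(** Asking for [r <= f c] on all of [C] is a cone of demands precisely because
    [C] is convex. *)
Lemma cone_of_convex C (r : R) : convex_set C -> C !=set0 ->
  cone_set [set g : X * R | exists t c, [/\ 0 <= t, C c & g = (t *: c, t * r)]].
Proof.
move=> cC [c0 Cc0]; split.
- by exists 0, c0; rewrite scale0r mul0r.
- move=> _ _ [s [c [s0 Cc ->]]] [t [d [t0 Cd ->]]] /=.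
  have [st0|st0] := eqVneq (s + t) 0.
    have -> : s = 0 by lra.
    have -> : t = 0 by lra.
    by exists 0, c0; rewrite !scale0r !mul0r !addr0.
  have stp : 0 < s + t by rewrite lt_neqAle eq_sym st0 addr_ge0.
  exists (s + t), ((s / (s + t)) *: c + (1 - s / (s + t)) *: d); split.
  + by rewrite ltW.
  + apply: (convexP C).1 => //; first by rewrite divr_ge0// ltW.
    by rewrite ler_pdivrMr// mul1r lerDl.
  + rewrite mulrDl; congr (_ , _); rewrite scalerDr !scalerA.
    congr (_ *: _ + _ *: _); first by rewrite mulrC divfK.
    by rewrite mulrBr mulrCA divff// !mulr1 addrAC subrr add0r.
- move=> u _ u0 [t [c [t0 Cc ->]]] /=; exists (u * t), c; split=> //.
    by rewrite mulr_ge0// ltW.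
  by rewrite scalerA mulrA.
Qed.

(** Separation of [C] from the open ball of radius [r] around 0. *)
Lemma functional_separating C (r : R) : convex_set C -> C !=set0 ->
  (forall c, C c -> r <= `|c|) ->
  exists2 f : {linear X -> R^o}, (forall x, f x <= `|x|) &
    forall c, C c -> r <= f c.
Proof.
move=> cC C0 Cr.
have [|f [f1 fC]] := hahn_banach_cone (norm_sublinear ler01) (cone_of_convex r cC C0).
- move=> _ [t [c [t0 Cc ->]]] /=; rewrite mul1r normrZ ger0_norm//.
  by rewrite ler_wpM2l// Cr.
- exists f => [x|c Cc]; first by have := f1 x; rewrite mul1r.
  have := fC (c, r); apply; exists 1, c; split=> //.
  by rewrite scale1r mul1r.
Qed.

Lemma norming_functional x : exists2 f : {linear X -> R^o},
  (forall y, f y <= `|y|) & f x = `|x|.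
Proof.
have [|||f f1 fx] := @functional_separating [set x] `|x|.
- by apply/convexP => y z t _ _ -> ->; rewrite /= -scalerDl addrC subrK scale1r.
- by exists x.
- by move=> _ ->.
- by exists f => //; apply/eqP; rewrite eq_le f1 fx.
Qed.

Lemma separation C x : convex_set C -> C !=set0 -> ~ closure C x ->
  exists (f : {linear X -> R^o}) (b : R),
    [/\ continuous f, b < f x & forall c, C c -> f c <= b].
Proof.
move=> cC [c0 Cc0] /closure_normP/existsNP[e /not_implyP[e0 /forall2NP Ce]].
have [|||f f1 fC] := @functional_separating [set x - c | c in C] e.
- apply/convexP => _ _ t t0 t1 [c Cc <-] [d Cd <-] /=.
  exists (t *: c + (1 - t) *: d); first exact: (convexP C).1.
  rewrite !scalerBr addrACA -opprD -scalerDl.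
  by rewrite (addrC t) subrK scale1r.
- by exists (x - c0), c0.
- by move=> _ [c Cc <-]; have [//|/negP] := Ce c; rewrite -leNgt.
- exists f, (f x - e); split.
  + by apply: (@dominated_continuous _ _ _ 1) => y; rewrite mul1r.
  + by rewrite ltrBlDr ltrDl.
  + move=> c Cc; have : e <= f (x - c) by apply: fC; exists c.
    by rewrite linearB /=; lra.
Qed.

(** Norm-preserving extension of the restriction of [f] to the hyperplane
    [ker phi]: demanding [f y <= h y] on the whole hyperplane forces equality,
    as [- y] is in it too. *)
Lemma functional_extension (phi f : {linear X -> R^o}) (M : R) : 0 <= M ->
  (forall y, phi y = 0 -> f y <= M * `|y|) ->
  exists2 h : {linear X -> R^o}, (forall x, h x <= M * `|x|) &
    forall y, phi y = 0 -> h y = f y.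
Proof.
move=> M0 fM.
have [|g|h [hM hf]] := @hahn_banach_cone _ _ _
    [set (y, f y) | y in [set y | phi y = 0]] (norm_sublinear M0).
- split.
  + by exists 0; rewrite /= ?linear0.
  + move=> _ _ [y /= y0 <-] [z /= z0 <-]; exists (y + z); rewrite /= ?linearD//.
    by rewrite /= y0 z0 addr0.
  + move=> t _ t0 [y /= y0 <-]; exists (t *: y); rewrite /= ?functionalZ//.
    by rewrite y0 mulr0.
- by move=> [y /= y0 <-] /=; exact: fM.
- exists h => // y y0; apply/eqP; rewrite eq_le.
  have fh z : phi z = 0 -> f z <= h z by move=> z0; apply: (hf (z, f z)); exists z.
  by rewrite fh// andbT -lerN2 -!linearN fh// linearN y0 oppr0.
Qed.

End convexity.

(** * Slices of the unit ball in a space with the Daugavet property *)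

Section rank_one_operators.
Variables (R : realType) (X : completeNormedModType R).
Variables (f : {linear X -> R^o}) (y : X).

Definition rank_one_op (x : X) : X := f x *: y.

Let rank_one_op_linear : linear rank_one_op.
Proof. by move=> t u v; rewrite /rank_one_op linearD functionalZ scalerDl scalerA. Qed.

HB.instance Definition _ :=
  GRing.isLinear.Build R X X *:%R rank_one_op rank_one_op_linear.

End rank_one_operators.

Section daugavet.
Variables (R : realType) (X : completeNormedModType R).
Hypothesis hX : Daugavet_property X.
Implicit Types (f g : {linear X -> R^o}) (x y w v : X) (K : set X).

(** The Daugavet equation for the operator [x |-> f x *: y]; here [s] is the
    norm of [f]. *)
Lemma daugavet_functional f y : continuous f -> (exists x, f x != 0) ->
  `|y| = 1 ->
  exists s : R, [/\ 0 < s, forall x, `|x| <= 1 -> `|f x| <= s &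
    forall e, 0 < e -> exists2 x, `|x| <= 1 & 1 + s - e < `|x + f x *: y|].
Proof.
move=> cf [x0 fx0] y1.
have [M M0 fM] := continuous_bound cf.
have x00 : x0 != 0 by apply: contraNN fx0 => /eqP ->; rewrite linear0.
have y0 : y != 0 by rewrite -normr_gt0 y1.
pose T : {linear X -> X} := rank_one_op f y.
have nT x : `|T x| = `|f x| by rewrite normrZ y1 mulr1.
have fB x : `|x| <= 1 -> `|f x| <= M.
  by move=> x1; apply: (le_trans (fM x)); rewrite ler_piMr// ltW.
have supT : has_sup [set `|T x| | x in [set x : X | `|x| <= 1]].
  split; first by exists `|T 0|, 0; rewrite /= ?normr0.
  by exists M => _ [x /= x1 <-]; rewrite nT; exact: fB.
have supIT : has_sup [set `|x + T x| | x in [set x : X | `|x| <= 1]].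
  split; first by exists `|0 + T 0|, 0; rewrite /= ?normr0.
  exists (1 + M) => _ [x /= x1 <-]; apply: (le_trans (ler_normD _ _)).
  by rewrite lerD// nT; exact: fB.
have Ts x : `|x| <= 1 -> `|f x| <= opnorm T.
  by move=> x1; rewrite -nT; apply: sup_upper_bound => //; exists x.
have dT : opnorm (fun x => x + T x) = 1 + opnorm T.
  apply: hX.
    move=> r; exists (M * r) => x xr; rewrite nT (le_trans (fM x))//.
    by rewrite ler_wpM2l// ltW.
  exists y => //; apply/seteqP; split=> [_ [x _ <-]|_ [c _ <-]].
    by exists (f x).
  exists ((c / f x0) *: x0) => //.
  by rewrite /T /= /rank_one_op functionalZ divfK.
exists (opnorm T); split=> //.
  apply: lt_le_trans (Ts (`|x0|^-1 *: x0) _); last first.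
    by rewrite normrZ normfV normr_id mulVf// normr_eq0.
  by rewrite normr_gt0 functionalZ mulf_neq0// invr_eq0 normr_eq0.
move=> e e0; have [_ [x /= x1 <-]] := sup_adherent e0 supIT.
by rewrite -/(opnorm _) dT; exists x.
Qed.


(** With [w = `|w| *: u] and [T x = - f x *: u], some [z] of the ball has
    [`|z + T z|] almost [1 + `|f|]; compose [I + T] with a functional [g] norming
    [z + T z].  Wherever [g \o (I + T)] is almost maximal on the ball, [f] and [g]
    are almost maximal and [g u] is almost -1, so [g] shows that [`|w - x|] is
    almost [`|w| + 1].  That the conclusion holds on a whole smaller slice, and
    not at one point only, is what allows iterating over several [w]. *)
Lemma slice_refine_neq0 f (b d : R) w : continuous f -> (exists x, f x != 0) ->
  0 < d -> (exists2 x, `|x| <= 1 & b < f x) ->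
  exists (f' : {linear X -> R^o}) (b' : R),
    [/\ continuous f', exists2 x, `|x| <= 1 & b' < f' x &
      forall x, `|x| <= 1 -> b' < f' x -> b < f x /\ `|w| + 1 - d <= `|w - x|].
Proof.
move=> cf f0 d0 [x1 x11 bx1].
have [u u1 wu] : exists2 u : X, `|u| = 1 & w = `|w| *: u.
  have [w0|w0] := eqVneq w 0.
    have [x fx] := f0; exists (`|x|^-1 *: x).
      rewrite normrZ normfV normr_id mulVf// normr_eq0.
      by apply: contraNN fx => /eqP ->; rewrite linear0.
    by rewrite w0 normr0 scale0r.
  exists (`|w|^-1 *: w); first by rewrite normrZ normfV normr_id mulVf ?normr_eq0.
  by rewrite scalerA divff ?scale1r// normr_eq0.
have [|s [s0 fs fe]] := @daugavet_functional f (- u) cf f0; first by rewrite normrN.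
have bs : b < s.
  by apply: (lt_le_trans bx1); apply: le_trans (fs _ x11); exact: ler_norm.
(* [e] is small enough for f > s - e to imply f > b and for the loss
   e (1 + |w| / s) to be at most d *)
pose e := Num.min (Num.min (s - b) (s / 2)) (d / (1 + `|w| / s)).
have c0 : 0 < 1 + `|w| / s by rewrite ltr_pwDl// divr_ge0// ltW.
have e0 : 0 < e by rewrite !lt_min subr_gt0 bs !divr_gt0.
have es : e <= s / 2 by rewrite /e !ge_min lexx orbT.
have eb : e <= s - b by rewrite /e !ge_min lexx.
have ed : e * (1 + `|w| / s) <= d.
  by rewrite -ler_pdivlMr// /e !ge_min lexx orbT.
have [z [z1 fz0 zT]] :
    exists z, [/\ `|z| <= 1, 0 <= f z & 1 + s - e < `|z + f z *: - u|].
  have [z z1 zT] := fe e e0.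
  have [fz|fz] := leP 0 (f z); first by exists z.
  exists (- z); rewrite linearN scaleNr -opprD !normrN oppr_ge0.
  by split=> //; exact: ltW.
have [g g1 gz] := norming_functional (z + f z *: - u).
have gB x : `|x| <= 1 -> g x <= 1 by move=> x1'; exact: le_trans (g1 x) x1'.
pose c := - g u.
have c1 : c <= 1 by rewrite /c -linearN -u1 -(normrN u) g1.
pose f' : {linear X -> R^o} := g \+ c \*: f.
have f'E x : f' x = g x + c * f x by [].
exists f', (1 + s - e); split.
- have [N N0 fN] := continuous_bound cf.
  apply: (@dominated_continuous _ _ _ (1 + `|c| * N)) => x.
  rewrite f'E mulrDl mul1r lerD//.
  by rewrite (le_trans (ler_norm _))// normrM -mulrA ler_wpM2l.
- exists z => //; rewrite f'E; move: zT; rewrite -gz linearD functionalZ linearN /c.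
  by rewrite (mulrC (f z)).
have c0' : 0 < c.
  have : s - e < c * f z.
    move: zT; rewrite -gz linearD functionalZ linearN -/c (mulrC _ c).
    by have := gB _ z1; lra.
  by nra.
move=> x x1'; rewrite f'E => f'x.
have gx := gB _ x1'; have fx := le_trans (ler_norm _) (fs _ x1').
have fx0 : 0 < f x by nra.
split; first by nra.
have cs : 1 - e / s <= c.
  rewrite lerBlDr -lerBlDl ler_pdivlMr// mulrBl mul1r.
  by nra.
have gxe : 1 - e <= g x by nra.
apply: (@le_trans _ _ (g (x - w))); last by rewrite distrC; exact: g1.
rewrite linearB /= [in g w]wu functionalZ.
have -> : g u = - c by rewrite opprK.
have : `|w| * (1 - e / s) <= `|w| * c by rewrite ler_wpM2l.
have -> : `|w| * (1 - e / s) = `|w| - e * (`|w| / s) by ring.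
by lra.
Qed.

End daugavet.

Section l1_far.
Variables (R : realType) (X : completeNormedModType R).
Implicit Types (f g : {linear X -> R^o}) (x y w v : X) (K : set X) (b d : R).

(** Up to [d], the vector [v] is added to those of [K] as in an l1-sum. *)
Definition l1_far K d v : Prop := forall w, K w -> `|w| + 1 - d <= `|w - v|.

Lemma compact_net K (e : R) : compact K -> 0 < e ->
  exists ws : seq X, forall w, K w -> exists2 w', w' \in ws & `|w - w'| < e.
Proof.
rewrite compact_cover => cK e0.
have [|w Kw|D DK KD] := cK _ K (fun w => ball w e).
- by move=> w _; exact: ball_open.
- by exists w => //; exact: ballxx.
exists (enum_fset D) => w /KD[w' /= w'D].
by rewrite -ball_normE /= distrC => ww'; exists w'.
Qed.

(** Being far from [v] passes to the segment from 0 to [v], by the triangle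
    inequality. *)
Lemma l1_farZ d v w (t : R) : `|v| <= 1 -> 0 <= t -> t <= 1 ->
  `|w| + 1 - d <= `|w - v| -> `|w| + t - d <= `|w - t *: v|.
Proof.
move=> v1 t0 t1 wv.
have : `|w - v| <= `|w - t *: v| + (1 - t) * `|v|.
  have -> : (1 - t) * `|v| = `|(1 - t) *: v| by rewrite normrZ ger0_norm// subr_ge0.
  rewrite (le_trans _ (ler_normB _ _))//.
  by rewrite scalerBl scale1r opprB addrA subrK.
by nra.
Qed.

End l1_far.

Section daugavet_far.
Variables (R : realType) (X : completeNormedModType R).
Hypothesis hX : Daugavet_property X.
Hypothesis X_neq0 : exists x : X, x != 0.
Implicit Types (f g : {linear X -> R^o}) (x y w v : X) (K : set X) (b d : R).

(** For [f = 0] the slice is the whole ball and any slice of a nonzero functional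
    can be refined instead. *)
Lemma slice_refine f b d w : continuous f -> 0 < d ->
  (exists2 x, `|x| <= 1 & b < f x) ->
  exists (f' : {linear X -> R^o}) b',
    [/\ continuous f', exists2 x, `|x| <= 1 & b' < f' x &
      forall x, `|x| <= 1 -> b' < f' x -> b < f x /\ `|w| + 1 - d <= `|w - x|].
Proof.
move=> cf d0 [x1 x11 bx1].
have [f0|f0] := pselect (exists x, f x != 0).
  by apply: slice_refine_neq0 => //; exists x1.
have {}f0 x : f x = 0 by apply/eqP; apply: contra_notT f0 => fx; exists x.
have [u u0] := X_neq0; have [g g1 gu] := norming_functional u.
have cg : continuous g.
  by apply: (@dominated_continuous _ _ _ 1) => y; rewrite mul1r.
have gu0 : 0 < g u by rewrite gu normr_gt0.
have [||f' [b' [cf' fb' ff']]] := @slice_refine_neq0 _ _ hX g 0 d w cg _ d0.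
- by exists u; rewrite gt_eqF.
- exists (`|u|^-1 *: u); first by rewrite normrZ normfV normr_id mulVf ?normr_eq0.
  by rewrite functionalZ mulr_gt0// invr_gt0 normr_gt0.
- exists f', b'; split=> // x x1' f'x; have [_ ?] := ff' _ x1' f'x.
  by split=> //; rewrite f0 -(f0 x1).
Qed.

Lemma slice_refine_seq f b d (ws : seq X) : continuous f -> 0 < d ->
  (exists2 x, `|x| <= 1 & b < f x) ->
  exists (f' : {linear X -> R^o}) b',
    [/\ continuous f', exists2 x, `|x| <= 1 & b' < f' x &
      forall x, `|x| <= 1 -> b' < f' x -> b < f x /\ l1_far [set` ws] d x].
Proof.
move=> cf d0; elim: ws => [|w ws IH] fb; first by exists f, b; split.
have [g [c [cg gc gP]]] := IH fb.
have [f' [b' [cf' fb' f'P]]] := slice_refine w cg d0 gc.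
exists f', b'; split=> // x x1 f'x.
have [cx wx] := f'P _ x1 f'x; have [bx wsx] := gP _ x1 cx.
by split=> // w'; rewrite /= inE => /predU1P[->|/wsx].
Qed.

Lemma slice_meets_l1_far f b d K : compact K -> continuous f -> 0 < d ->
  (exists2 x, `|x| <= 1 & b < f x) ->
  exists x, [/\ `|x| <= 1, b < f x & l1_far K d x].
Proof.
move=> cK cf d0 fb; have d4 : 0 < d / 4 by rewrite divr_gt0.
have [ws wsP] := compact_net cK d4.
have [f' [b' [_ [x x1 f'x] f'P]]] := slice_refine_seq ws cf d4 fb.
have [bx xws] := f'P _ x1 f'x.
exists x; split=> // w /wsP[w' /xws w'x ww'].
have : `|w| <= `|w'| + `|w - w'| by rewrite -[in leLHS](subrK w' w) addrC ler_normD.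
have : `|w' - x| <= `|w - x| + `|w - w'|.
  by have := ler_normD (w' - w) (w - x); rewrite addrA subrK (distrC w' w); lra.
by lra.
Qed.

End daugavet_far.

(** * The same property for a closed hyperplane *)

Section kernel.
Variables (R : realType) (X : completeNormedModType R).
Hypothesis hX : Daugavet_property X.
Variables (phi : {linear X -> R^o}) (e : X).
Hypotheses (phi1 : forall x, phi x <= `|x|) (phie : phi e = 1) (e1 : `|e| = 1).
Implicit Types (f h : {linear X -> R^o}) (x y w v : X) (K : set X) (b d : R).

Let X_neq0 : exists x : X, x != 0.
Proof. by exists e; rewrite -normr_eq0 e1 oner_eq0. Qed.

Let phi_norm x : `|phi x| <= `|x|.
Proof.
by have := @dominated_norm _ _ phi 1 _ x; rewrite mul1r; apply => y; rewrite mul1r.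
Qed.

Let cphi : continuous phi.
Proof. by apply: (@dominated_continuous _ _ _ 1) => y; rewrite mul1r. Qed.

(** A vector almost of norm 1 and almost in [ker phi] is close to a unit vector
    of [ker phi]. *)
Let project_unit v (t : R) : `|v| <= 1 -> 1 - t <= `|v| -> `|phi v| <= t -> t < 2^-1 ->
  exists2 z, phi z = 0 /\ `|z| = 1 & `|z - v| <= 3 * t.
Proof.
move=> v1 vt pt t2; pose z := v - phi v *: e.
have zv : `|z - v| <= t.
  by rewrite /z addrAC subrr add0r normrN normrZ e1 mulr1.
have zn : `|1 - `|z| | <= 2 * t.
  have := ler_normD (z - v) v; rewrite subrK.
  have := ler_normB z (z - v); rewrite opprB addrC subrK.
  by rewrite ler_norml; lra.
have z0 : 0 < `|z| by move: zn; rewrite ler_norml; lra.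
exists (`|z|^-1 *: z).
  split; last by rewrite normrZ normfV normr_id mulVf// gt_eqF.
  by rewrite functionalZ linearB /= functionalZ phie mulr1 subrr mulr0.
have -> : `|z|^-1 *: z - v = (`|z|^-1 - 1) *: z + (z - v).
  by rewrite scalerBl scale1r addrA subrK.
rewrite (le_trans (ler_normD _ _))// normrZ.
have -> : `| `|z|^-1 - 1| * `|z| = `|1 - `|z| |.
  by rewrite -{2}(normr_id z) -normrM mulrBl mul1r mulVf// gt_eqF.
by lra.
Qed.

(** Slices of the unit ball of [ker phi] also contain vectors far from [K].  Let
    [M] be the norm of [f] on [ker phi] and [h] an extension of [f] of norm [M].
    Tilting [h] slightly by [phi], in both directions, gives two slices of the
    ball of the whole space on which [h] is almost [M], and [phi] is almost
    nonpositive on one, almost nonnegative on the other.  Take [v1] in the first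
    far from [K], then [v2] in the second far from [K] - [0, 1] [v1].  Some convex
    combination of [v1] and [v2] almost lies in [ker phi]; it is still far from
    [K], and it is then moved to the unit sphere of [ker phi]. *)
Lemma ex_unit_kernel_l1_far f b d K : compact K -> K 0 -> continuous f -> 0 < d ->
  (exists x, [/\ phi x = 0, `|x| <= 1 & b < f x]) ->
  exists x, [/\ phi x = 0, `|x| = 1, b < f x & l1_far K d x].
Proof.
move=> cK K0 cf d0 [y0 [py0 y01 by0]].
have [N N0 fN] := continuous_bound cf.
pose S := [set f y | y in [set y | phi y = 0 /\ `|y| <= 1]].
have supS : has_sup S.
  split; first by exists (f y0), y0.
  exists N => _ [y [_ y1] <-]; rewrite (le_trans (ler_norm _))// (le_trans (fN _))//.
  by rewrite ler_piMr// ltW.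
pose M := sup S.
have SM y : phi y = 0 -> `|y| <= 1 -> f y <= M.
  by move=> py y1; apply: sup_upper_bound => //; exists y.
have bM : b < M by rewrite (lt_le_trans by0) ?SM.
have M0 : 0 <= M by rewrite -(linear0 f) SM ?linear0 ?normr0.
have [y py|h hM hf] := @functional_extension _ _ phi f M M0.
  have [->|y0'] := eqVneq y 0; first by rewrite linear0 normr0 mulr0.
  have yp : 0 < `|y| by rewrite normr_gt0.
  rewrite mulrC -ler_pdivrMl// -functionalZ SM//.
    by rewrite functionalZ py mulr0.
  by rewrite normrZ normfV normr_id mulVf ?gt_eqF.
have hB x : `|x| <= 1 -> h x <= M.
  by move=> x1; rewrite (le_trans (hM x))// ler_piMr.
have ch : continuous h by exact: dominated_continuous hM.
(* the tilt; the three bounds make the projection to the sphere possible, the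
   total loss of distance at most d, and the total loss on f less than M - b *)
pose k := Num.min (Num.min 8^-1 (d / 12)) ((M - b) / (8 * (1 + M))).
have k0 : 0 < k by rewrite !lt_min !divr_gt0 ?subr_gt0 ?mulr_gt0 ?ltr_pwDl//; lra.
have k8 : k <= 8^-1 by rewrite /k !ge_min lexx.
have kd : 12 * k <= d by rewrite mulrC -ler_pdivlMr// /k !ge_min lexx orbT.
have kM : k * (8 * (1 + M)) <= M - b.
  by rewrite -ler_pdivlMr ?mulr_gt0 ?ltr_pwDl// /k !ge_min lexx orbT.
clearbody k.
(* a point of the slice of [h + t phi], for |t| = k: it almost maximizes [h]
   and [phi] has almost the sign of [t] there *)
have tilted (t : R) K' : compact K' -> t = k \/ t = - k ->
    exists v, [/\ `|v| <= 1, M - 2 * k <= h v, - k ^+ 2 < t * phi v & l1_far K' k v].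
  move=> cK' tk.
  have [|_ [y1 [py1 y11] <-] fy1] := sup_adherent (_ : 0 < k ^+ 2) supS.
    by rewrite exprn_gt0.
  pose ht : {linear X -> R^o} := h \+ t \*: phi.
  have htE x : ht x = h x + t * phi x by [].
  have [||v [v1 hv Kv]] := @slice_meets_l1_far _ _ hX X_neq0 ht (M - k ^+ 2) k K' cK' _ k0.
  - apply: (@dominated_continuous _ _ _ (M + `|t|)) => x.
    rewrite htE mulrDl lerD// (le_trans (ler_norm _))// normrM.
    by rewrite ler_wpM2l.
  - by exists y1 => //; rewrite htE py1 mulr0 addr0 hf.
  exists v; split=> //.
  - move: hv; rewrite htE.
    have : t * phi v <= k.
      rewrite (le_trans (ler_norm _))// normrM.
      have -> : `|t| = k by case: tk => ->; rewrite ?normrN gtr0_norm.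
      by apply: ler_piMr; [exact: ltW|exact: le_trans (phi_norm _) v1].
    by rewrite expr2; nra.
  - by move: hv; rewrite htE; have := hB _ v1; lra.
have [v1 [v11 hv1 pv1 Kv1]] := tilted (- k) K cK (or_intror erefl).
pose F (z : X * R) : X := z.1 - z.2 *: v1.
pose K1 := F @` (K `*` `[0, 1]).
have cK1 : compact K1.
  apply: continuous_compact; last by apply: compact_setX => //; exact: segment_compact.
  apply: continuous_subspaceT => z; apply: cvgB; first exact: cvg_fst.
  by apply: cvgZr_tmp; exact: cvg_snd.
have [v2 [v21 hv2 pv2 Kv2]] := tilted k K1 cK1 (or_introl erefl).
have {}pv1 : phi v1 < k by nra.
have {}pv2 : - k < phi v2 by nra.
have [t [t0 t1 pt]] : exists t : R, [/\ 0 <= t, t <= 1 &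
    `|phi (t *: v1 + (1 - t) *: v2)| <= k].
  have E t : phi (t *: v1 + (1 - t) *: v2) = t * phi v1 + (1 - t) * phi v2.
    by rewrite linearD !functionalZ.
  have [p1|p1] := ltP (- k) (phi v1).
    by exists 1; rewrite E ler_norml; split; lra.
  have [p2|p2] := ltP (phi v2) k.
    by exists 0; rewrite E ler_norml; split; lra.
  have p12 : 0 < phi v2 - phi v1 by lra.
  exists (phi v2 / (phi v2 - phi v1)); split.
  - by rewrite divr_ge0//; lra.
  - by rewrite ler_pdivrMr//; lra.
  - have -> : phi (phi v2 / (phi v2 - phi v1) *: v1
        + (1 - phi v2 / (phi v2 - phi v1)) *: v2) = 0.
      by rewrite E; field; rewrite gt_eqF.
    by rewrite normr0 ltW.
set v := t *: v1 + (1 - t) *: v2 in pt.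
have Kv : l1_far K (2 * k) v.
  move=> w Kw; have := l1_farZ v11 t0 t1 (Kv1 _ Kw).
  have /Kv2 : K1 (w - t *: v1) by exists (w, t) => //=; rewrite in_itv /= t0 t1.
  move=> /(l1_farZ v21 (_ : 0 <= 1 - t) (_ : 1 - t <= 1)).
  rewrite subr_ge0 t1 gerBl t0 => /(_ isT isT).
  have -> : w - v = w - t *: v1 - (1 - t) *: v2 by rewrite /v opprD addrA.
  by lra.
have v1' : `|v| <= 1.
  rewrite (le_trans (ler_normD _ _))// !normrZ (ger0_norm t0) ger0_norm ?subr_ge0//.
  by nra.
have vlow : 1 - 2 * k <= `|v|.
  by have := Kv _ K0; rewrite normr0 add0r sub0r normrN.
have hv : M - 2 * k <= h v.
  rewrite /v linearD !(functionalZ h).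
  have := ler_wpM2l t0 hv1.
  have : (1 - t) * (M - 2 * k) <= (1 - t) * h v2 by rewrite ler_wpM2l ?subr_ge0.
  by lra.
have [||z [pz z1] zv] := @project_unit v (2 * k) v1' vlow.
- by rewrite (le_trans pt)//; lra.
- by lra.
have zv6 : `|z - v| <= 6 * k by lra.
exists z; split=> //.
- rewrite -hf//.
  have : h (v - z) <= M * (6 * k).
    by rewrite (le_trans (hM _))// ler_wpM2l// distrC.
  rewrite linearB /=.
  by nra.
- move=> w Kw; have := Kv _ Kw.
  have : `|w - v| <= `|w - z| + `|z - v|.
    by rewrite (le_trans _ (ler_normD _ _))// addrA subrK.
  by lra.
Qed.

Lemma kernel_sub_closed_hull_l1_far K d y : compact K -> K 0 -> 0 < d ->
  phi y = 0 -> `|y| <= 1 ->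
  closed_hull [set v | [/\ phi v = 0, `|v| = 1 & l1_far K d v]] y.
Proof.
move=> cK K0 d0 py y1; apply: contrapT => ny.
pose V := [set v | [/\ phi v = 0, `|v| = 1 & l1_far K d v]].
have [|f [b [cf bf fb]]] := @separation _ _ (convex_hull V) y (@convex_hull_convex _ _ _) _ ny.
  have [|z [pz z1 _ zK]] := @ex_unit_kernel_l1_far phi (-1) d K cK K0 cphi d0.
    by exists 0; rewrite linear0 normr0; split=> //; lra.
  by exists z; apply: sub_convex_hull.
have [|v [pv v1 bv Kv]] := @ex_unit_kernel_l1_far f b d K cK K0 cf d0.
  by exists y.
have : f v <= b by apply: fb; apply: sub_convex_hull.
by rewrite leNgt bv.
Qed.

End kernel.

(** * A self-reproducing sequence *)

Section box.
Variables (R : realType) (X : completeNormedModType R).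
Implicit Types (y z : nat -> X) (c d t : R) (m n : nat).

(** Combinations of the first [m] terms with coefficients in [[-c, c]]; bounding
    the coefficients makes the set compact, so that it has finite nets. *)
Fixpoint box y c m : set X :=
  if m is k.+1 then [set w + t *: y k | w in box y c k & t in `[- c, c]]
  else [set 0].

Lemma box0 y c m : 0 <= c -> box y c m 0.
Proof.
move=> c0; elim: m => //= m IH; exists 0 => //; exists 0.
  by rewrite /= in_itv /=; lra.
by rewrite scale0r addr0.
Qed.

Lemma box_compact y c m : compact (box y c m).
Proof.
elim: m => [|m IH] /=; first exact: compact_set1.
pose F (p : X * R) : X := p.1 + p.2 *: y m.
have -> : [set w + t *: y m | w in box y c m & t in `[- c, c]] =
    F @` (box y c m `*` `[- c, c]%classic).
  apply/seteqP; split=> [_ [w mw] [t ct] <-|_ [[w t] [/= mw ct]] <-].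
    by exists (w, t).
  by exists w => //; exists t.
apply: continuous_compact; last by apply: compact_setX => //; exact: segment_compact.
apply: continuous_subspaceT => p; apply: cvgD; first exact: cvg_fst.
by apply: cvgZr_tmp; exact: cvg_snd.
Qed.

Lemma eq_box y z c m : (forall k, (k < m)%N -> y k = z k) -> box y c m = box z c m.
Proof.
elim: m => //= m IH yz; rewrite IH ?yz//.
by move=> k km; rewrite yz// ltnS ltnW.
Qed.

Lemma box_mono y c d m n : 0 <= d -> c <= d -> (m <= n)%N ->
  box y c m `<=` box y d n.
Proof.
move=> d0 cd; elim: n => [|n IH]; first by rewrite leqn0 => /eqP ->.
have itv t : t \in `[- c, c] -> t \in `[- d, d] by rewrite !in_itv /=; lra.
rewrite leq_eqVlt => /predU1P[->|mn].
  move=> _ [w mw] [t ct] <-; exists w; last by exists t => //; exact: itv.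
  elim: n w mw {IH} => //= n IH w [w' /IH w'd] [s cs] <-.
  by exists w' => //; exists s => //; exact: itv.
move=> w /IH wd; exists w; first exact: wd.
by exists 0; rewrite ?scale0r ?addr0//= in_itv /=; lra.
Qed.

Lemma box_add y c d m k w t : (k < m)%N -> 0 <= d -> `|t| <= d ->
  box y c m w -> box y (c + d) m (w + t *: y k).
Proof.
move=> + d0 td; elim: m w => // m IH w; rewrite ltnS leq_eqVlt.
have td' : - d <= t /\ t <= d by move: td; rewrite ler_norml => /andP.
move=> km [w' mw'] [s cs] <-.
have cs' : - c <= s /\ s <= c by move: cs; rewrite /= in_itv /= => /andP.
have c0 : 0 <= c by lra.
move: km => /predU1P[->|km].
  exists w'; first by apply: (box_mono _ _ (leqnn m) mw'); lra.
  exists (s + t); last by rewrite scalerDl addrA.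
  by rewrite /= in_itv /=; lra.
exists (w' + t *: y k); first exact: IH.
exists s; last by rewrite addrAC.
by rewrite /= in_itv /=; lra.
Qed.

End box.

Section tree.
Variables (R : realType) (X : completeNormedModType R).
Variable Y : set X.
Hypothesis Yfar : forall K d y, compact K -> K 0 -> 0 < d -> Y y ->
  closed_hull [set v | Y v /\ l1_far K d v] y.
Implicit Types (L l : seq X) (y v : X) (K : set X) (n m : nat) (d : R).

Lemma finite_l1_far_approx K d L : compact K -> K 0 -> 0 < d ->
  (forall y, y \in L -> Y y) ->
  exists l, (forall v, v \in l -> Y v /\ l1_far K d v) /\
    forall y, y \in L -> exists2 z, convex_hull [set` l] z & `|y - z| < d.
Proof.
move=> cK K0 d0; elim: L => [|y L IH] YL; first by exists [::].
have [|l [lY lL]] := IH; first by move=> z zL; apply: YL; rewrite inE zL orbT.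
have /(Yfar cK K0 d0) /closure_normP /(_ _ d0)[z hz yz] : Y y.
  by apply: YL; rewrite inE eqxx.
have [k kY kz] := convex_hull_finite hz.
exists (l ++ k); split=> [v|x].
  by rewrite mem_cat => /orP[/lY|/kY].
rewrite inE => /predU1P[->|/lL[x' lx' xx']].
  exists z => //; apply: convex_hullS kz => v /= vk.
  by rewrite mem_cat vk orbT.
exists x' => //; apply: convex_hullS lx' => v /= vl.
by rewrite mem_cat vl.
Qed.

(** Stage [n + 1] appends to the finite list of stage [n] finitely many vectors
    of [Y], far from the box spanned by the list, whose convex hull comes within
    [1 / (n + 1)] of every vector of the list.  So each term of the sequence is a
    limit of convex combinations of arbitrarily late terms, all far from what
    was constructed before them. *)
Lemma ex_tree_sequence u v : Y u -> Y v -> exists y : nat -> X,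
  [/\ y 0%N = u, y 1%N = v, forall n, Y (y n) &
    forall n m d, 0 < d ->
      closed_hull [set y j | j in [set j | (m <= j)%N /\ l1_far (box y m%:R m) d (y j)]]
        (y n)].
Proof.
move=> Yu Yv.
pose K n L := box (nth 0 L) n%:R (size L).
pose good n L l := (forall v, v \in l -> Y v /\ l1_far (K n L) n.+1%:R^-1 v) /\
    forall y, y \in L -> exists2 z, convex_hull [set` l] z & `|y - z| < n.+1%:R^-1.
(* the hypothesis on p.2 is inside the existential, so that choice gives one
   extension function defined on all lists *)
have ext_ex (p : nat * seq X) : exists l,
    (forall y, y \in p.2 -> Y y) -> good p.1 p.2 l.
  have [H|H] := pselect (forall y, y \in p.2 -> Y y); last by exists [::].
  have [|||l lP] := @finite_l1_far_approx (K p.1 p.2) p.1.+1%:R^-1 p.2 _ _ _ H.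
  - exact: box_compact.
  - exact: box0.
  - by rewrite invr_gt0.
  - by exists l.
have [ext extP] := choice ext_ex.
pose stage := nat_rect (fun=> seq X) [:: u; v] (fun n L => L ++ ext (n, L)).
have stageS n : stage n.+1 = stage n ++ ext (n, stage n) by [].
have stageY n y : y \in stage n -> Y y.
  elim: n y => [|n IH] y.
    by rewrite !inE => /orP[/eqP ->|/eqP ->].
  rewrite stageS mem_cat => /orP[/IH//|].
  by have [H _] := extP (n, stage n) IH => /H[].
have extG n : good n (stage n) (ext (n, stage n)) by apply: extP; exact: stageY.
have stage_prefix m n : (m <= n)%N -> exists l, stage n = stage m ++ l.
  elim: n => [|n IH]; first by rewrite leqn0 => /eqP ->; exists [::]; rewrite cats0.
  rewrite leq_eqVlt => /predU1P[->|/IH[l nl]]; first by exists [::]; rewrite cats0.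
  by exists (l ++ ext (n, stage n)); rewrite stageS {1}nl catA.
have size_stage n : (n.+1 < size (stage n))%N.
  elim: n => // n IH; rewrite stageS size_cat.
  suff : (0 < size (ext (n, stage n)))%N by move=> H; rewrite -addn1 leq_add.
  have [_ /(_ (nth 0 (stage n) 0))[|z hz _]] := extG n.
    by rewrite mem_nth// (leq_trans _ IH).
  rewrite lt0n; apply: contraPneq hz => /size0nil ->.
  rewrite (_ : [set` [::]] = set0) ?convex_hull0//.
  by apply/seteqP; split.
pose y n := nth 0 (stage n) n.
have ynth n k : (k < size (stage n))%N -> y k = nth 0 (stage n) k.
  move=> kn; have [nk|nk] := leqP n k.
    by have [l kl] := stage_prefix _ _ nk; rewrite /y kl nth_cat kn.
  have [l nl] := stage_prefix _ _ (ltnW nk); rewrite /y nl nth_cat.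
  by rewrite (leq_trans _ (size_stage k)).
exists y; split=> //.
  by move=> n; apply: (stageY n); rewrite mem_nth// (leq_trans _ (size_stage n)).
move=> n m d d0; apply/closure_normP => e e0.
pose N0 := Num.trunc (Num.max d^-1 e^-1).
pose N := maxn (maxn n m) N0.
have Nn : (n <= N)%N by rewrite /N !leq_max leqnn.
have Nm : (m <= N)%N by rewrite /N !leq_max leqnn orbT.
have N0N : (N0 <= N)%N by rewrite /N leq_max leqnn orbT.
have [Nd Ne] : N.+1%:R^-1 < d /\ N.+1%:R^-1 < e.
  have : Num.max d^-1 e^-1 < N.+1%:R.
    by rewrite (lt_le_trans (truncnS_gt _))// ler_nat ltnS.
  rewrite gt_max => /andP[dN eN].
  by split; rewrite invf_plt ?posrE.
have [lY lL] := extG N.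
have yn : y n \in stage N.
  by rewrite (ynth N) ?mem_nth// (leq_ltn_trans Nn)// (leq_trans _ (size_stage N)).
have [z hz yz] := lL _ yn.
exists z; last exact: lt_trans Ne.
apply: convex_hullS hz => w /= wl.
have [Yw wfar] := lY _ wl.
pose j := (size (stage N) + index w (ext (N, stage N)))%N.
have yj : y j = w.
  rewrite (ynth N.+1); last first.
    by rewrite stageS size_cat /j ltn_add2l index_mem.
  by rewrite stageS nth_cat /j ltnNge leq_addr/= addKn nth_index.
have Ns : (N <= size (stage N))%N by apply/ltnW/ltnW/size_stage.
exists j => //=; split.
  by rewrite /j (leq_trans Nm)// (leq_trans Ns)// leq_addr.
have mK : box y m%:R m `<=` K N (stage N).
  rewrite /K -(@eq_box _ _ y); last by move=> k; exact: ynth.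
  by apply: box_mono; rewrite ?ler_nat//; exact: leq_trans Ns.
by rewrite yj => x /mK/wfar; apply: le_trans; rewrite lerB// ltW.
Qed.

End tree.

(** * Hulls of strongly exposed points are SCD *)

Section strongly_exposed.
Variables (R : realType) (X : completeNormedModType R).
Implicit Types (a x y : X) (g : {linear X -> R^o}) (A B : set X).

Lemma norm_le_bounded_set A (M : R) : (forall x, A x -> `|x| <= M) -> bounded_set A.
Proof.
move=> AM; exists M; split; first exact: num_real.
by move=> N MN x /AM xM; rewrite /= (le_trans xM)// ltW.
Qed.

(** The inequality defines a closed convex set.  It makes [g] strongly expose
    [a]: points of a thin slice in the direction [g] are close to [a]. *)
Lemma closed_hull_peak A g a (C : R) : continuous g -> 0 < C ->
  (forall x, A x -> `|x - a| <= C * (g a - g x)) ->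
  forall x, closed_hull A x -> `|x - a| <= C * (g a - g x).
Proof.
move=> cg C0 AC; pose F x : R := `|x - a| + C * (g x - g a).
have FE x : (`|x - a| <= C * (g a - g x)) = (F x <= 0).
  by rewrite /F -lerBrDr sub0r -mulrN opprB.
suff H : closed_hull A `<=` [set x | F x <= 0] by move=> x /H; rewrite FE.
apply: closed_hull_min.
- apply/convexP => x y t t0 t1 /= xC yC.
  have E : t *: x + (1 - t) *: y - a = t *: (x - a) + (1 - t) *: (y - a).
    by rewrite !scalerBr addrACA -opprD -scalerDl (addrC t) subrK scale1r.
  have := ler_normD (t *: (x - a)) ((1 - t) *: (y - a)).
  rewrite -E !normrZ (ger0_norm t0) ger0_norm ?subr_ge0//.
  move: xC yC; rewrite /F linearD !(functionalZ g).
  have t1' : 0 <= 1 - t by rewrite subr_ge0.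
  move=> xC yC; have := ler_wpM2l t0 xC; have := ler_wpM2l t1' yC.
  by lra.
- apply: (@preimage_closed _ _ F [set r | r <= 0]); last exact: closed_le.
  move=> x _.
  have xa : (fun z => z - a) @ x --> x - a.
    by apply: cvgB; [exact: cvg_id|exact: cvg_cst].
  have gx : (fun z => C * (g z - g a)) @ x --> C * (g x - g a).
    by apply: cvgMl_tmp; apply: cvgB; [exact: cg|exact: cvg_cst].
  exact: (cvgD (cvg_norm xa) gx).
- by move=> x /AC; rewrite FE.
Qed.

(** The slices of width [1 / (m + 1)] around all the [a n] are determining: a set
    meeting all of them has every [a n] in its closure. *)
Lemma SCD_strongly_exposed (a : nat -> X) (g : nat -> {linear X -> R^o}) (C : nat -> R) :
  (forall n, continuous (g n)) -> (forall n, exists x, g n x != 0) ->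
  (forall n, 0 < C n) ->
  (forall n k, `|a k - a n| <= C n * (g n (a n) - g n (a k))) ->
  SCD (closed_hull (range a)).
Proof.
move=> cg g0 C0 aC; set A := closed_hull _.
have Aa n : A (a n) by apply: sub_closed_hull; exists n.
have AC n x : A x -> `|x - a n| <= C n * (g n (a n) - g n x).
  by apply: closed_hull_peak => // _ [k _ <-].
have gA n x : A x -> g n x <= g n (a n).
  by move=> /(AC n)/(le_trans (normr_ge0 _)); rewrite pmulr_rge0// subr_ge0.
have supg n : sup (g n @` A) = g n (a n).
  apply/eqP; rewrite eq_le; apply/andP; split.
    apply: ge_sup; first by exists (g n (a n)), (a n).
    by move=> _ [x Ax <-]; exact: gA.
  apply: ub_le_sup; last by exists (a n).
  by exists (g n (a n)) => _ [x Ax <-]; exact: gA.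
(* decodes i into the pair (number of the point, width) *)
pose dec (i : nat) : nat * nat := odflt (0, 0)%N (choice.unpickle i).
pose U i := slice A (g (dec i).1) (dec i).2.+1%:R^-1.
have U0 i : U i !=set0.
  exists (a (dec i).1); split=> //=.
  by rewrite supg gtrBl invr_gt0.
exists U; first by move=> i; split=> //; exists (g (dec i).1), ((dec i).2.+1%:R^-1).
split=> [i|B BU]; first by split=> // x [].
rewrite -/(closed_hull B) /A; apply: closed_hullS => _ [n _ <-].
have cl : closure B (a n).
  apply/closure_normP => d d0.
  have [m md] : exists m : nat, C n * m.+1%:R^-1 < d.
    exists (Num.truncn (C n / d)).
    by rewrite ltr_pdivrMr// mulrC -ltr_pdivrMr// truncnS_gt.
  have [b [Bb []]] := BU (choice.pickle (n, m)).
  rewrite /U /dec choice.pickleK /= supg => Ab ab.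
  exists b => //; rewrite distrC (le_lt_trans (AC n b Ab))//.
  by apply: le_lt_trans md; rewrite ler_pM2l// lerBlDr -lerBlDl ltW.
by apply: (closureS _ cl); exact: sub_convex_hull.
Qed.

End strongly_exposed.

(** * Lifting the sequence out of the hyperplane *)

Section lifted.
Variables (R : realType) (X : completeNormedModType R).
Implicit Types (e x : X) (y : nat -> X) (phi : {linear X -> R^o}).

Definition height n : R := n.+1%:R^-1.

(** The coefficients [(1 - s ^+ 2, s)], with [s] the height, run on a parabola; its
    strict concavity exposes the lifted points one by one, and the heights tend
    to 0, so that nothing of the sequence itself is lost in the closed hull. *)
Definition lift y e n : X := (1 - height n ^+ 2) *: y n + height n *: e.

Lemma height_gt0 n : 0 < height n.
Proof. by rewrite invr_gt0. Qed.

Lemma height_le1 n : height n <= 1.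
Proof. by rewrite invf_le1// ler1n. Qed.

Lemma height_sq n : 0 <= 1 - height n ^+ 2 <= 1.
Proof. by have := height_gt0 n; have := height_le1 n; nra. Qed.

Lemma height_gap n k : k != n ->
  height n * height n.+1 <= `|height n - height k|.
Proof.
move=> kn.
have gap i : height i - height i.+1 = height i * height i.+1.
  rewrite /height -(natr1 i.+1); field.
  by apply/andP; split; rewrite lt0r_neq0//; have := ler0n R i; lra.
have mono i j : (i <= j)%N -> height j <= height i.
  by move=> ij; rewrite lef_pV2 ?posrE// ler_nat.
case: (ltngtP k n) kn => [kn _|nk _|//]; last first.
  by rewrite -gap (le_trans _ (ler_norm _))// lerB// mono.
rewrite distrC (le_trans _ (ler_norm _))//.
case: n kn => // n; rewrite ltnS => /mono kn.
have := gap n; have := mono n.+1 n.+2 (leqnSn _).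
have := mono n n.+1 (leqnSn _).
have := height_gt0 n.+1; have := height_gt0 n; have := height_gt0 n.+2.
by nra.
Qed.

Lemma lift_norm y e n : (forall n, `|y n| = 1) -> `|e| = 1 -> `|lift y e n| <= 2.
Proof.
move=> y1 e1; rewrite (le_trans (ler_normD _ _))// !normrZ y1 e1 !mulr1.
have /andP[h0 h1] := height_sq n.
by rewrite (ger0_norm h0) gtr0_norm ?height_gt0//; have := height_le1 n; lra.
Qed.

(** Let [f n] be a norming functional of [y n].  Correcting it by a multiple of
    [phi] gives [g n] of norm at most 1 on the [y k] and of value [2 s_n] at [e],
    the slope of the parabola at its [n]-th point.  Then [g n] at the [k]-th lifted
    point is at most [1 - s_k ^+ 2 + 2 s_n s_k], which is
    [1 + s_n ^+ 2 - (s_n - s_k) ^+ 2], with equality for [k = n]. *)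
Lemma SCD_lift phi e y : continuous phi -> phi e = 1 -> `|e| = 1 ->
  (forall n, phi (y n) = 0) -> (forall n, `|y n| = 1) ->
  SCD (closed_hull (range (lift y e))).
Proof.
move=> cphi phie e1 py y1.
have fex n : exists f : {linear X -> R^o}, (forall x, f x <= `|x|) /\ f (y n) = 1.
  by have [f f1 fy] := norming_functional (y n); exists f; rewrite fy y1.
have [f fP] := choice fex.
pose g n : {linear X -> R^o} := f n \+ (2 * height n - f n e) \*: phi.
have gE n k : g n (lift y e k) =
    (1 - height k ^+ 2) * f n (y k) + 2 * height n * height k.
  have -> : g n (lift y e k) =
      f n (lift y e k) + (2 * height n - f n e) * phi (lift y e k) by [].
  by rewrite /lift !linearD !functionalZ py phie; ring.
have gn n : g n (lift y e n) = 1 + height n ^+ 2.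
  by rewrite gE (fP n).2; ring.
have gk n k : (height n - height k) ^+ 2 <= g n (lift y e n) - g n (lift y e k).
  have fk : f n (y k) <= 1 by rewrite -(y1 k); exact: (fP n).1.
  have /andP[h0 _] := height_sq k.
  rewrite gn gE.
  have := ler_wpM2l h0 fk.
  by lra.
(* 4 bounds the distance of two lifted points *)
pose C n : R := 4 / (height n * height n.+1) ^+ 2.
have h0 n : 0 < (height n * height n.+1) ^+ 2.
  by rewrite exprn_gt0// mulr_gt0// height_gt0.
apply: (@SCD_strongly_exposed _ _ _ g C) => [n|n|n|n k].
- have [N N0 phiN] := continuous_bound cphi.
  apply: (@dominated_continuous _ _ _ (1 + `|2 * height n - f n e| * N)) => x.
  have -> : g n x = f n x + (2 * height n - f n e) * phi x by [].
  rewrite [leRHS]mulrDl mul1r lerD//; first exact: (fP n).1.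
  by rewrite (le_trans (ler_norm _))// normrM -mulrA ler_wpM2l.
- by exists (lift y e n); rewrite gn gt_eqF// ltr_pwDl// sqr_ge0.
- by rewrite divr_gt0.
- have [->|kn] := eqVneq k n; first by rewrite !subrr normr0 mulr0.
  apply: (@le_trans _ _ 4).
    rewrite (le_trans (ler_normB _ _))//.
    by have := lift_norm k y1 e1; have := lift_norm n y1 e1; lra.
  rewrite /C mulrAC ler_pdivlMr// ler_pM2l// (le_trans _ (gk n k))//.
  rewrite -[leRHS]real_normK ?num_real// ler_sqr ?nnegrE//.
    exact: height_gap.
  by rewrite mulr_ge0// ltW// height_gt0.
Qed.

End lifted.

(** * The sum of the two lifted hulls is not SCD *)

Section cube.
Variables (R : realType) (X : completeNormedModType R).
Implicit Types (b : nat -> X) (m n : nat).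

(** Combinations with coefficients in [[0, 1]]: a convex superset of the simplex
    that is easier to build one vector at a time. *)
Fixpoint cube b n : set X :=
  if n is k.+1 then [set x + t *: b k | x in cube b k & t in `[0, 1]]
  else [set 0].

Lemma cube_mono b m n : (m <= n)%N -> cube b m `<=` cube b n.
Proof.
elim: n => [|n IH]; first by rewrite leqn0 => /eqP ->.
rewrite leq_eqVlt => /predU1P[-> //|/IH mn x /mn xn].
by exists x => //; exists 0; rewrite ?scale0r ?addr0//= in_itv /= lexx ler01.
Qed.

Lemma cube_convex b n : convex_set (cube b n).
Proof.
elim: n => [|n IH]; apply/convexP => x y t t0 t1.
  by move=> /= -> ->; rewrite !scaler0 addr0.
move=> [x' xn [r r01 <-]] [y' yn [s s01 <-]].
exists (t *: x' + (1 - t) *: y'); first exact: (convexP _).1.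
exists (t * r + (1 - t) * s).
  by move: r01 s01; rewrite /= !in_itv /= => /andP[? ?] /andP[? ?]; apply/andP; split; nra.
by rewrite !scalerDr [(t * r + _) *: _]scalerDl !scalerA addrACA.
Qed.

Lemma bigcup_cube_convex b : convex_set (\bigcup_n cube b n).
Proof.
apply/convexP => x y t t0 t1 [m _ xm] [n _ yn].
exists (maxn m n) => //; apply: (convexP _).1 => //; first exact: cube_convex.
  exact: (cube_mono (leq_maxl m n) xm).
exact: (cube_mono (leq_maxr m n) yn).
Qed.

Lemma in_bigcup_cube b n : (\bigcup_n cube b n) (b n).
Proof.
exists n.+1 => //; exists 0.
  exact: (cube_mono (leq0n n)).
by exists 1; rewrite ?scale1r ?add0r//= in_itv /= lexx ler01.
Qed.

End cube.

Section not_SCD.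
Variables (R : realType) (X : completeNormedModType R).
Variables (phi : {linear X -> R^o}) (e : X) (y : nat -> X).
Hypotheses (phi1 : forall x, `|phi x| <= `|x|) (phie : phi e = 1) (e1 : `|e| = 1).
Hypotheses (phiy : forall n, phi (y n) = 0) (y1 : forall n, `|y n| = 1).
Hypothesis yN : y 1%N = - y 0%N.
Hypothesis y_tree : forall n m (d : R), 0 < d ->
  closed_hull [set y j | j in [set j | (m <= j)%N /\ l1_far (box y m%:R m) d (y j)]]
    (y n).
Implicit Types (f : {linear X -> R^o}) (x v : X) (n m j k : nat) (b d : R).

Local Notation lift_hull e := (closed_hull (range (lift y e))).

Lemma lift_dist (e' : X) j : `|e'| = 1 -> `|y j - lift y e' j| <= 2 * height R j.
Proof.
move=> e'1.
have -> : y j - lift y e' j = height R j ^+ 2 *: y j - height R j *: e'.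
  by rewrite /lift opprD addrA scalerBl scale1r subKr.
have h0 := height_gt0 R j; have h1 := height_le1 R j.
rewrite (le_trans (ler_normB _ _))// !normrZ y1 e'1 !mulr1.
rewrite (ger0_norm (ltW h0)).
have : height R j * height R j <= height R j by rewrite ler_piMr// ltW.
by lra.
Qed.

(** [y n] is a limit of convex combinations of late terms, which differ little
    from their lifts. *)
Lemma seq_in_lift_hull (e' : X) n : `|e'| = 1 -> lift_hull e' (y n).
Proof.
move=> e'1; apply/closure_normP => d d0.
have [m md] : exists m : nat, 2 * height R m < d / 2.
  exists (Num.truncn (4 / d)).
  rewrite /height ltr_pdivrMr// mulrC -ltr_pdivrMr ?divr_gt0//.
  by rewrite invf_div mulrA -natrM truncnS_gt.
have d2 : 0 < d / 2 by rewrite divr_gt0.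
have /closure_normP/(_ _ d2)[z hz yz] := @y_tree n m 1 ltr01.
have [a ha za] : exists2 a, convex_hull (range (lift y e')) a & `|z - a| <= 2 * height R m.
  pose C := [set z : X | exists2 a,
    convex_hull (range (lift y e')) a & `|z - a| <= 2 * height R m].
  apply: (@convex_hull_min _ _ _ C _ _ z hz).
    apply/convexP => p q t t0 t1 [a ha pa] [b hb qb].
    exists (t *: a + (1 - t) *: b).
      exact: (convexP _).1 (@convex_hull_convex _ _ _) _ _ _ t0 t1 ha hb.
    rewrite opprD addrACA -!scalerBr (le_trans (ler_normD _ _))// !normrZ.
    rewrite (ger0_norm t0) ger0_norm ?subr_ge0//.
    by nra.
  move=> _ [j [mj _] <-]; exists (lift y e' j).
    by apply: sub_convex_hull; exists j.
  rewrite (le_trans (lift_dist j e'1))// ler_pM2l//.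
  by rewrite lef_pV2 ?posrE// ler_nat.
exists a => //; have := ler_normD (y n - z) (z - a); rewrite addrA subrK.
by lra.
Qed.

Lemma tree_functional f n m d b : continuous f -> 0 < d -> b < f (y n) ->
  exists j, l1_far (box y m%:R m) d (y j) /\ b < f (y j).
Proof.
move=> cf d0 bn; apply: contrapT => /forallNP H.
suff : f (y n) <= b by rewrite leNgt bn.
apply: (closed_hull_le cf _ (@y_tree n m d d0)) => _ [j [_ jfar] <-].
rewrite leNgt; apply/negP => bj; exact: (H j).
Qed.

Lemma lift_hull_functional f (e' : X) x b : continuous f -> lift_hull e' x ->
  b < f x -> exists k, b < f (lift y e' k).
Proof.
move=> cf hx bx; apply: contrapT => /forallNP H.
suff : f x <= b by rewrite leNgt bx.
apply: (closed_hull_le cf _ hx) => _ [k _ <-].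
by rewrite leNgt; apply/negP; exact: H.
Qed.

(** When [f e' <= 0] the lifts do not help [f]: its supremum over the hull is
    already approached on the sequence.  The supremum over the sequence is
    nonnegative because [y 1 = - y 0], so shrinking [y k] by [1 - s ^+ 2] does not
    raise it either. *)
Lemma lift_hull_le f (e' : X) x b : continuous f -> f e' <= 0 ->
  lift_hull e' x -> b < f x -> exists n, b < f (y n).
Proof.
move=> cf fe hx bx; apply: contrapT => /forallNP H.
have {}H n : f (y n) <= b by rewrite leNgt; apply/negP; exact: H.
have b0 : 0 <= b by have := H 0%N; have := H 1%N; rewrite yN linearN /=; lra.
suff : f x <= b by rewrite leNgt bx.
apply: (closed_hull_le cf _ hx) => _ [k _ <-].
rewrite /lift linearD !(functionalZ f).
have /andP[h0 h1] := height_sq R k; have hk := height_gt0 R k.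
have : height R k * f e' <= 0 by rewrite mulr_ge0_le0// ltW.
have := ler_wpM2l h0 (H k).
by nra.
Qed.

(** The projection onto [ker phi] along [e]. *)
Definition proj x : X := x - phi x *: e.

Lemma projD x v : proj (x + v) = proj x + proj v.
Proof. by rewrite /proj linearD scalerDl opprD addrACA. Qed.

Lemma projZ (t : R) x : proj (t *: x) = t *: proj x.
Proof. by rewrite /proj functionalZ scalerBr scalerA. Qed.

Lemma proj_ker x : phi x = 0 -> proj x = x.
Proof. by move=> px; rewrite /proj px scale0r subr0. Qed.

Lemma proj_norm x : `|proj x| <= 2 * `|x|.
Proof.
rewrite /proj (le_trans (ler_normB _ _))// normrZ e1 mulr1.
by have := phi1 x; lra.
Qed.

Lemma proj_lift (t : R) k : proj (lift y (t *: e) k) = (1 - height R k ^+ 2) *: y k.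
Proof.
rewrite /lift projD !projZ proj_ker// /proj phie scale1r subrr !scaler0.
by rewrite addr0.
Qed.

Lemma half_slice f (e1' e2' : X) x v c : continuous f -> f e1' <= 0 ->
  lift_hull e1' x -> lift_hull e2' v -> c < f x + f v ->
  exists k, forall m d, 0 < d -> exists j,
    l1_far (box y m%:R m) d (y j) /\ c < f (y j + lift y e2' k).
Proof.
move=> cf fe hx hv cxv; pose t := (f x + f v - c) / 2.
have t0 : 0 < t by rewrite divr_gt0// subr_gt0.
have [k kv] : exists k, f v - t < f (lift y e2' k).
  by apply: lift_hull_functional hv _ => //; rewrite gtrBl.
have [n nx] : exists n, f x - t < f (y n).
  by apply: lift_hull_le hx _ => //; rewrite gtrBl.
exists k => m d d0; have [j [jfar xj]] := tree_functional m cf d0 nx.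
exists j; split=> //; rewrite linearD /=.
by move: kv xj; rewrite /t; lra.
Qed.

(** For any functional [f], either [f e <= 0] or [f (- e) <= 0], so in every direction
    one of the two summands has slices meeting the sequence [y], and hence
    containing terms far from a given box.  The quantifier order matters: the
    companion index [k], from the other summand, is fixed before the box, which
    may therefore be chosen to contain [y k]. *)
Lemma slice_has_far (S : set X) :
  is_slice (minkowski_sum (lift_hull e) (lift_hull (- e))) S ->
  exists k, forall m d, 0 < d -> exists j z,
    [/\ l1_far (box y m%:R m) d (y j), S z &
      proj z = (1 - height R k ^+ 2) *: y k + y j].
Proof.
move=> [[s0 S0] [f [r [cf _ r0 SE]]]]; rewrite SE in S0 *.
have [[a ha [b hb <-]]] := S0; set c := _ - r; rewrite linearD => cab.
have inL (e' : X) k : lift_hull e' (lift y e' k) by apply: sub_closed_hull; exists k.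
have eN : `|- e| = 1 by rewrite normrN.
have [fe|fe] := leP (f e) 0.
  have [k kP] := half_slice cf fe ha hb cab.
  exists k => m d d0; have [j [jfar jk]] := kP m d d0.
  exists j, (y j + lift y (- e) k); split=> //.
    split=> //; exists (y j); first exact: seq_in_lift_hull.
    by exists (lift y (- e) k).
  by rewrite projD proj_ker// -scaleN1r proj_lift addrC.
have fNe : f (- e) <= 0 by rewrite linearN oppr_le0 ltW.
have [|k kP] := half_slice cf fNe hb ha (_ : c < _); first by rewrite addrC.
exists k => m d d0; have [j [jfar jk]] := kP m d d0.
exists j, (lift y e k + y j); split=> //.
  split; last by rewrite addrC in jk.
  by exists (lift y e k) => //; exists (y j) => //; exact: seq_in_lift_hull.
by rewrite projD (proj_ker (phiy j)) -{1}(scale1r e) proj_lift.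
Qed.

(** In the [n]-th slice choose a point [z n] whose projection is
    [b n = r *: y (k n) + y (j n)] with [0 <= r <= 1] and [y (j n)] far from everything
    chosen before.  Subtracting [t *: b n] from a vector [w] of the box spanned so far
    lowers the norm by at most [t] because of [r *: y (k n)] and raises it by almost
    [t] because of [y (j n)].  Starting from [2 *: y 0], whose norm is 2, the
    distance to all the cubes spanned by the [b n] stays above 1, so [2 *: y 0], a
    point of the sum, is not in the closed convex hull of the [z n]. *)
Lemma lift_sum_not_SCD : ~ SCD (minkowski_sum (lift_hull e) (lift_hull (- e))).
Proof.
move=> [U slU [_ Udet]].
have [k kP] := choice (fun n => slice_has_far (slU n)).
have far_ex (p : nat * nat) : exists jz : nat * X,
    [/\ l1_far (box y p.2%:R p.2) (2^-1 ^+ p.1.+1) (y jz.1), U p.1 jz.2 &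
      proj jz.2 = (1 - height R (k p.1) ^+ 2) *: y (k p.1) + y jz.1].
  have [|j [z jzP]] := kP p.1 p.2 (2^-1 ^+ p.1.+1); first by rewrite exprn_gt0.
  by exists (j, z).
have [F FP] := choice far_ex.
(* a size of the box large enough for y (k n) and for all coefficients so far;
   M n bounds the indices used before step n *)
pose next n M := maxn (maxn M (k n).+1) (n.*2 + 4).
pose M := nat_rect (fun=> nat) 1%N
  (fun n Mn => maxn (next n Mn) (F (n, next n Mn)).1.+1).
pose m n := next n (M n).
pose j n := (F (n, m n)).1.
pose z n := (F (n, m n)).2.
have MS n : M n.+1 = maxn (m n) (j n).+1 by [].
pose b n : X := (1 - height R (k n) ^+ 2) *: y (k n) + y (j n).
have [jfar Uz zb] : [/\ forall n, l1_far (box y (m n)%:R (m n)) (2^-1 ^+ n.+1) (y (j n)),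
    forall n, U n (z n) & forall n, proj (z n) = b n].
  by split=> n; have [] := FP (n, m n).
have Mm n : (M n <= m n)%N by rewrite /m /next !leq_max leqnn.
have km n : (k n < m n)%N by rewrite /m /next !leq_max leqnn orbT.
have nm n : (n.*2 + 4 <= m n)%N by rewrite /m /next !leq_max leqnn orbT.
have mM n : (m n <= M n.+1)%N by rewrite MS leq_maxl.
have jM n : (j n < M n.+1)%N by rewrite MS leq_maxr.
pose u2 : X := 2 *: y 0%N.
have norm_coef n (t : R) : 0 <= t <= 1 -> `|- (t * (1 - height R (k n) ^+ 2))| <= t.
  move=> /andP[t0 t1]; have /andP[h0 h1] := height_sq R (k n).
  by rewrite normrN ger0_norm ?mulr_ge0// ler_piMr.
(* removing the part of [t *: b n] that is not the far vector [y (j n)] *)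
have box_step n x (t : R) : 0 <= t <= 1 ->
    box y (n.*2 + 2)%:R (M n) (u2 - x) ->
    box y (n.*2 + 3)%:R (m n) (u2 - x - (t * (1 - height R (k n) ^+ 2)) *: y (k n)).
  move=> t01 bx; rewrite -scaleNr.
  have -> : (n.*2 + 3)%:R = (n.*2 + 2)%:R + 1 :> R by rewrite addnS natr1.
  apply: box_add => //.
    by rewrite (le_trans (norm_coef n t t01))//; case/andP: t01.
  by apply: box_mono bx; rewrite ?ler0n.
have bE n x (t : R) : u2 - (x + t *: b n) =
    u2 - x - (t * (1 - height R (k n) ^+ 2)) *: y (k n) - t *: y (j n).
  by rewrite /b scalerDr scalerA !opprD !addrA.
have cube_box n x : cube b n x -> box y (n.*2 + 2)%:R (M n) (u2 - x).
  elim: n x => [|n IH] x.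
    move=> /= ->; rewrite subr0 /u2.
    have n2 : `|2 : R| <= 2 by rewrite ger0_norm.
    have := box_add (ltn0Sn 0) (ler0n R 2) n2 (box0 y 1 (lexx (0 : R))).
    by rewrite !add0r.
  move=> [x' /IH bx' [t t01 <-]].
  have {}t01 : 0 <= t <= 1 by move: t01; rewrite /= in_itv.
  have := box_step n x' t t01 bx'; rewrite bE.
  set w := u2 - x' - _ => bw.
  have -> : (n.+1.*2 + 2)%:R = (n.*2 + 3)%:R + 1 :> R by rewrite natr1 doubleS !addSn -!addnS.
  rewrite -scaleNr; apply: box_add => //.
    by rewrite normrN; case/andP: t01 => t0 t1; rewrite ger0_norm.
  by apply: box_mono bw; rewrite ?ler0n.
have cube_far n x : cube b n x -> 1 + 2^-1 ^+ n <= `|u2 - x|.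
  elim: n x => [|n IH] x.
    by move=> /= ->; rewrite subr0 /u2 normrZ y1 mulr1 ger0_norm.
  move=> [x' xn [t t01 <-]].
  have {}t01 : 0 <= t <= 1 by move: t01; rewrite /= in_itv.
  have := box_step n x' t t01 (cube_box n x' xn); rewrite bE.
  set w := u2 - x' - _ => bw.
  have {}bw : box y (m n)%:R (m n) w.
    apply: box_mono bw => //; rewrite ler_nat (leq_trans _ (nm n))//.
    by rewrite leq_add2l.
  have /andP[t0 t1] := t01.
  have yj1 : `|y (j n)| <= 1 by rewrite y1.
  have := l1_farZ yj1 t0 t1 (jfar n _ bw).
  have := IH _ xn.
  have : `|u2 - x'| <= `|w| + t.
    have -> : u2 - x' = w + (t * (1 - height R (k n) ^+ 2)) *: y (k n).
      by rewrite /w subrK.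
    rewrite (le_trans (ler_normD _ _))// lerD2l normrZ y1 mulr1 -normrN.
    exact: norm_coef.
  by rewrite exprS; lra.
have zU n : range z `&` U n !=set0 by exists (z n); split=> //; exists n.
have u2AD : minkowski_sum (lift_hull e) (lift_hull (- e)) u2.
  exists (y 0%N); first exact: seq_in_lift_hull.
  exists (y 0%N); first by apply: seq_in_lift_hull; rewrite normrN.
  by rewrite /u2 scaler_nat mulr2n.
have /closure_normP/(_ 2^-1)[|x xh xu2] := Udet (range z) zU u2 u2AD.
  by rewrite invr_gt0.
have [N _ xN] : (\bigcup_n cube b n) (proj x).
  pose C := [set x | (\bigcup_n cube b n) (proj x)].
  apply: (@convex_hull_min _ _ _ C _ _ x xh).
    apply/convexP => p q t t0 t1 /= hp hq.
    rewrite /C /= projD !projZ.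
    exact: (convexP _).1 (@bigcup_cube_convex _ _ b) _ _ _ t0 t1 hp hq.
  by move=> _ [n _ <-] /=; rewrite /C /= zb; exact: in_bigcup_cube.
have u2P : proj u2 = u2 by rewrite /u2 projZ proj_ker.
have : `|u2 - proj x| <= 2 * `|u2 - x|.
  have -> : u2 - proj x = proj (u2 - x) by rewrite projD u2P -[- x]scaleN1r projZ scaleN1r.
  exact: proj_norm.
have := cube_far _ _ xN.
have : (0 : R) < 2^-1 ^+ N by rewrite exprn_gt0.
by lra.
Qed.

End not_SCD.

(** * The counterexample *)

Theorem theorem2p7 (R : realType) (X : completeNormedModType R)
    (X_neq0 : exists x : X, x != 0) (hX : Daugavet_property X) :
  exists A D : set X,
    [/\ convex_set A, closed A & bounded_set A] /\
    [/\ convex_set D, closed D & bounded_set D] /\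
    SCD A /\ SCD D /\ ~ SCD (minkowski_sum A D).
Proof.
have [x0 x00] := X_neq0; have [phi phi1 phix0] := norming_functional x0.
have nx0 : 0 < `|x0| by rewrite normr_gt0.
pose e : X := `|x0|^-1 *: x0.
have e1 : `|e| = 1 by rewrite normrZ normfV normr_id mulVf// gt_eqF.
have phie : phi e = 1 by rewrite functionalZ phix0 mulVf// gt_eqF.
have phiM x : phi x <= 1 * `|x| by rewrite mul1r.
have cphi : continuous phi := dominated_continuous phiM.
have [|||u [pu u1 _ _]] := @ex_unit_kernel_l1_far _ _ hX phi e phi1 phie e1
    phi (-1) 1 [set 0] _ _ cphi ltr01.
- exact: compact_set1.
- by [].
- by exists 0; rewrite linear0 normr0; split=> //; lra.
pose Y := [set v | phi v = 0 /\ `|v| = 1].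
have Yfar K d y : compact K -> K 0 -> 0 < d -> Y y ->
    closed_hull [set v | Y v /\ l1_far K d v] y.
  move=> cK K0 d0 [py y1].
  have y1' : `|y| <= 1 by rewrite y1.
  have := kernel_sub_closed_hull_l1_far hX phi1 phie e1 cK K0 d0 py y1'.
  apply: closed_hullS => v [pv v1 vK]; exact: sub_closed_hull.
have [||y [y0 y1 yY y_tree]] := ex_tree_sequence Yfar (_ : Y u) (_ : Y (- u)).
- by split.
- by split; rewrite ?linearN ?pu ?oppr0 ?normrN.
have py n : phi (y n) = 0 by have [] := yY n.
have ny n : `|y n| = 1 by have [] := yY n.
have eN1 : `|- e| = 1 by rewrite normrN.
pose hull (e' : X) := closed_hull (range (lift y e')).
have hullP (e' : X) : `|e'| = 1 ->
    [/\ convex_set (hull e'), closed (hull e') & bounded_set (hull e')].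
  move=> e'1; split; [exact: closed_hull_convex|exact: closed_hull_closed|].
  apply: (@norm_le_bounded_set _ _ _ 2) => x hx; rewrite -(subr0 x).
  apply: closed_hull_dist hx => _ [n _ <-]; rewrite subr0.
  exact: lift_norm.
exists (hull e), (hull (- e)); split; first exact: hullP.
split; first exact: hullP.
split; last split.
- exact: SCD_lift cphi phie e1 py ny.
- pose psi : {linear X -> R^o} := \- phi.
  have psiE x : psi x = - phi x by [].
  apply: (@SCD_lift _ _ psi) => // [||n].
  + by move=> x; apply: cvgN; exact: cphi.
  + by rewrite psiE linearN opprK.
  + by rewrite psiE py oppr0.
- apply: (lift_sum_not_SCD (phi := phi)) => //; last by rewrite y1 y0.
  by move=> x; have := dominated_norm phiM x; rewrite mul1r.
Qed.
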